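(* Let $(X,\mathscr F,\mu,T)$ be an ergodic system, $\mathcal C$ a space of measurable cocycles, $\Xi$ a set of observables, and $\mathscr P$ a set of LDT parameters with corresponding spaces of deviation functions $\mathscr E$, $\mathscr I$. Let $A\in\mathcal C_m$ be such that $\Xi$ and $A$ are compatible and every observable $\xi\in\Xi$ satisfies a base-LDT with LDT parameters in $\mathscr P$. (i) Assume that $L_1(A)>-\infty$ and that $A$ is $L^1$-bounded. Then for every $\epsilon>0$ there are $\delta=\delta(A,\epsilon)>0$, $n_0=n_0(A,\epsilon)\in\mathbb N$ and $\iota=\iota(A,\epsilon)\in\mathscr I$ such that if $B\in\mathcal C_m$ with $\mathrm{dist}(B,A)<\delta$ and $n\ge n_0$, then $$\frac1n\log\|B^{(n)}(x)\|\le L_1(A)+\epsilon$$ for all $x$ outside a set of measure $<\iota_n$. Up to a zero measure set, the exceptional set (at scale $n$) depends only on $A,\epsilon$ and not on $B$: for each $n\ge n_0$ there is a set of measure $<\iota_n$, determined by $A$, $\epsilon$, $n$, such that for every such $B$ the bound holds for $\mu$-a.e. $x$ outside it. (ii) Assume that $L_1(A)=-\infty$. Then for every $t<\infty$ there are $\delta=\delta(A,t)>0$, $n_0=n_0(A,t)\in\mathbb N$ and $\iota=\iota(A,t)\in\mathscr I$ such that if $B\in\mathcal C_m$ with $\mathrm{dist}(B,A)<\delta$ and $n\ge n_0$, then $$\frac1n\log\|B^{(n)}(x)\|\le -t$$ for all $x$ outside a set of measure $<\iota_n$. Up to a zero measure set, the exceptional set (at scale $n$) depends only on $A,t$ and not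 on $B$, in the same sense as in (i).
   Context: Ergodic system: a probability space $(X,\mathscr F,\mu)$ with an ergodic measure preserving map $T:X\to X$. $\mathrm{Mat}_m(\mathbb R)$ denotes the $m\times m$ real matrices, $\|\cdot\|$ the operator norm, $\wedge_k g$ the $k$-th exterior power. Space of measurable cocycles: a class $\mathcal C$ of functions $A:X\to\mathrm{Mat}_m(\mathbb R)$ ($m\in\mathbb N$ not fixed) such that each $A\in\mathcal C$ is $\mathscr F$-measurable, $\|A\|\in L^\infty(\mu)$, and $\wedge_kA:X\to\mathrm{Mat}_{\binom mk}(\mathbb R)$ is in $\mathcal C$ for all $k\le m$. Each $\mathcal C_m:=\{A\in\mathcal C: A:X\to\mathrm{Mat}_m(\mathbb R)\}$ is endowed with a distance $\mathrm{dist}$ such that $\mathrm{dist}(B,A)\ge\|B-A\|_{L^\infty}$, and the maps $\mathcal C_m\ni A\mapsto\wedge_kA\in\mathcal C_{\binom mk}$ are locally Lipschitz. Iterates: $A^{(n)}(x)=A(T^{n-1}x)\cdots A(Tx)A(x)$, $A^{(0)}=I$. Top Lyapunov exponent: $L_1(A)=\lim_{n\to\infty}\int_X\frac1n\log\|A^{(n)}(x)\|\,\mu(dx)\in[-\infty,\infty)$. $A$ is $L^1$-bounded if there is $C<\infty$ with $\big\|\frac1n\log\|A^{(n)}(\cdot)\|\big\|_{L^1}<C$ for all $n\ge1$. Observables and compatibility: $\Xi$ is a set of measurable functions $\xi:X\to\mathbb R$. For $A\in\mathcal C$ and $N\in\mathbb N$, $\mathscr F_N(A)$ is the algebra of sets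 generated by the sets $\{x:\|A^{(n)}(x)\|\le c\}$ and $\{x:\|A^{(n)}(x)\|\ge c\}$, $c\ge0$, $0\le n\le N$. $\Xi$ and $A$ are compatible if for every $N\in\mathbb N$, $F\in\mathscr F_N(A)$ and $\epsilon>0$ there is $\xi\in\Xi$ with $\mathbf 1_F\le\xi$ and $\int_X\xi\,d\mu\le\mu(F)+\epsilon$. Deviation functions and LDT parameters: $\mathscr E$ is a set of non-increasing functions $e:(0,\infty)\to(0,\infty)$ (deviation sizes). $\mathscr I$ is a set of functions $\iota:(0,\infty)\to(0,\infty)$ (deviation set measures), each continuous and strictly decreasing to $0$ as $t\to\infty$, with $\log t\lesssim\log\frac1{\iota(t)}\lesssim t$ as $t\to\infty$ ($\lesssim$ means $\le$ up to a positive multiplicative constant), and such that the inverse $\phi_\iota$ of $\psi_\iota(t):=t\,[\iota(t)]^{-1/2}$ satisfies $\limsup_{t\to\infty}\phi_\iota(2t)/\phi_\iota(t)<2$. $\mathscr I$ is a convex cone: $a\iota\in\mathscr I$ and $\iota_1+\iota_2\in\mathscr I$ for $a>0$, $\iota,\iota_1,\iota_2\in\mathscr I$. $\mathscr P$ is a set of triplets $(\underline{n_0},e,\iota)$ with $\underline{n_0}\in\mathbb N$, $e\in\mathscr E$, $\iota\in\mathscr I$, such that for all $\epsilon>0$ there is $(\underline{n_0},e,\iota)\in\mathscr P$ with $e(\underline{n_0})\le\epsilon$. Write $e_n:=e(n)$, $\iota_n:=\iota(n)$. Base-LDT: $\xi$ (with $\int_X\xi\,d\mu$ finite) satisfies a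 base-LDT if for every $\epsilon>0$ there is $(\underline{n_0},e,\iota)\in\mathscr P$ such that for all $n\ge\underline{n_0}$: $e_n\le\epsilon$ and $\mu\{x:|\frac1n\sum_{j=0}^{n-1}\xi(T^jx)-\int_X\xi\,d\mu|>e_n\}<\iota_n$. *)

(* Defs.v *)
From HB Require Import structures.
From mathcomp Require Export all_boot all_order all_algebra.
From mathcomp Require Export all_classical all_reals all_analysis.
Import Order.TTheory GRing.Theory Num.Theory.
Export numFieldNormedType.Exports.

Set Implicit Arguments.
Unset Strict Implicit.
Unset Printing Implicit Defensive.

Local Open Scope classical_set_scope.
Local Open Scope ring_scope.

Section Matrices.
Context {R : realType}.

Definition euclidean_norm m (v : 'cV[R]_m) : R :=
  Num.sqrt (\sum_i v i 0 ^+ 2).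

(* The norm carried by 'M[R]_m in the library is the entrywise maximum, hence
   a separate definition. *)
Definition opnorm m (g : 'M[R]_m) : R :=
  sup [set euclidean_norm (g *m v) | v in [set v | euclidean_norm v <= 1]].

(* The indices of a basis vector e_(i_1) /\ ... /\ e_(i_k) of the k-th exterior
   power of R^m, i_1 < ... < i_k; there are 'C(m, k) of them. *)
Definition wedge_index (k m : nat) (i : 'I_('C(m, k))) : k.-tuple 'I_m :=
  enum_val (cast_ord (esym (card_ltn_sorted_tuples k m)) i).

(* In the basis above, the entries of the exterior power of g are the k x k
   minors of g. *)
Definition exterior_power (k m : nat) (g : 'M[R]_m) : 'M[R]_('C(m, k)) :=
  \matrix_(i, j)
    \det (mxsub (tnth (wedge_index i)) (tnth (wedge_index j)) g).

End Matrices.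

Section Systems.
Context {d : measure_display} {X : measurableType d} {R : realType}.
Variable mu : probability X R.

Record ergodic_system (T : X -> X) : Prop := ErgodicSystem {
  ergodic_measurable : measurable_fun setT T;
  ergodic_preserving : forall B, measurable B -> mu (T @^-1` B) = mu B;
  ergodic_invariant : forall B, measurable B -> T @^-1` B = B ->
    mu B = 0%E \/ mu B = 1%E }.

Definition norm_Linfty m (A : X -> 'M[R]_m) : \bar R :=
  Lnorm mu +oo%E (fun x => (opnorm (A x))%:E).

Definition wedge (k m : nat) (A : X -> 'M[R]_m) : X -> 'M[R]_('C(m, k)) :=
  fun x => exterior_power k (A x).

(* [cdist] separates points up to almost everywhere equality only: this covers
   both a class of functions taken literally and a class of functions modulo
   null sets, such as L^infty with the distance of its norm. *)
Record cocycle_space := CocycleSpace {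
  cocycles :> forall m, set (X -> 'M[R]_m);
  cdist : forall m, (X -> 'M[R]_m) -> (X -> 'M[R]_m) -> R;
  cocycle_measurable : forall m (A : X -> 'M[R]_m), cocycles A ->
    forall i j, measurable_fun setT (fun x => A x i j);
  cocycle_bounded : forall m (A : X -> 'M[R]_m), cocycles A ->
    (norm_Linfty A < +oo)%E;
  cocycle_wedge : forall k m (A : X -> 'M[R]_m), (0 < k <= m)%N ->
    cocycles A -> cocycles (wedge k A);
  cdist_ge0 : forall m (A B : X -> 'M[R]_m), cocycles A -> cocycles B ->
    0 <= cdist A B;
  cdist_refl : forall m (A : X -> 'M[R]_m), cocycles A -> cdist A A = 0;
  cdist_sep : forall m (A B : X -> 'M[R]_m), cocycles A -> cocycles B ->
    cdist A B = 0 -> {ae mu, forall x, A x = B x};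
  cdist_sym : forall m (A B : X -> 'M[R]_m), cocycles A -> cocycles B ->
    cdist A B = cdist B A;
  cdist_triangle : forall m (A B D : X -> 'M[R]_m),
    cocycles A -> cocycles B -> cocycles D ->
    cdist A D <= cdist A B + cdist B D;
  cdist_Linfty : forall m (A B : X -> 'M[R]_m), cocycles A -> cocycles B ->
    (norm_Linfty (fun x => B x - A x)%R <= (cdist B A)%:E)%E;
  wedge_locally_lipschitz : forall k m (A : X -> 'M[R]_m), (0 < k <= m)%N ->
    cocycles A ->
    exists r K : R, 0 < r /\
      forall B D : X -> 'M[R]_m, cocycles B -> cocycles D ->
        cdist B A < r -> cdist D A < r ->
        cdist (wedge k B) (wedge k D) <= K * cdist B D }.

Section Iterates.
Variables (T : X -> X) (m : nat) (A : X -> 'M[R]_m).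

Fixpoint iterate (n : nat) (x : X) : 'M[R]_m :=
  if n is n'.+1 then A (iter n' T x) *m iterate n' x else 1%:M.

(* Extended-real valued, since lne 0 = -oo. *)
Definition log_growth (n : nat) (x : X) : \bar R :=
  ((n%:R^-1)%:E * lne (opnorm (iterate n x))%:E)%E.

Definition lyapunov1 : \bar R := limn (fun n => \int[mu]_x log_growth n x)%E.

Definition L1_bounded : Prop :=
  exists c : R, forall n, (0 < n)%N -> (Lnorm mu 1 (log_growth n) < c%:E)%E.

Definition set_algebra (G : set (set X)) : Prop :=
  [/\ G setT, setC_closed G & setU_closed G].

Definition norm_algebra (N : nat) : set (set X) :=
  smallest set_algebra
    [set F | exists (n : nat) (c : R), [/\ (n <= N)%N, 0 <= c &
      F = [set x | opnorm (iterate n x) <= c] \/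
      F = [set x | c <= opnorm (iterate n x)]]].

Definition compatible (Xi : set (X -> R)) : Prop :=
  forall (N : nat) (F : set X) (eps : R), norm_algebra N F -> 0 < eps ->
    exists xi, [/\ Xi xi, (forall x, \1_F x <= xi x) &
      (\int[mu]_x (xi x)%:E <= mu F + eps%:E)%E].

End Iterates.

End Systems.

Section DeviationFunctions.
Context {R : realType}.

(* Functions from (0,oo) to (0,oo) are encoded as functions R -> R of which only
   the values at positive arguments are constrained. *)
Definition deviation_size (e : R -> R) : Prop :=
  (forall t : R, 0 < t -> 0 < e t) /\
  (forall s t : R, 0 < s -> s <= t -> e t <= e s).

Definition psi_of (iota : R -> R) (t : R) : R := t / Num.sqrt (iota t).

Definition phi_of (iota : R -> R) : R -> R :=
  'pinv_(fun=> 0) `]0, +oo[%classic (psi_of iota).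

Record deviation_measure (iota : R -> R) : Prop := DeviationMeasure {
  devm_gt0 : forall t : R, 0 < t -> 0 < iota t;
  devm_continuous : {in `]0, +oo[, continuous iota};
  devm_decreasing : forall s t : R, 0 < s -> s < t -> iota t < iota s;
  devm_cvg0 : iota t @[t --> +oo] --> 0;
  devm_lower : exists2 c : R, 0 < c &
    \forall t \near +oo, ln t <= c * ln (iota t)^-1;
  devm_upper : exists2 c : R, 0 < c &
    \forall t \near +oo, ln (iota t)^-1 <= c * t;
  devm_doubling :
    (limf_esup (fun t : R => (phi_of iota (2 * t) / phi_of iota t)%:E)
       (pinfty_nbhs R) < 2%:E)%E }.

End DeviationFunctions.

Record LDT_parameters (R : realType) := LDTParameters {
  sizes : set (R -> R);
  measures : set (R -> R);
  triplets :> set (nat * (R -> R) * (R -> R));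
  sizesP : forall e, sizes e -> deviation_size e;
  measuresP : forall iota, measures iota -> deviation_measure iota;
  measuresZ : forall (a : R) iota, 0 < a -> measures iota ->
    measures (fun t => a * iota t);
  measuresD : forall iota1 iota2, measures iota1 -> measures iota2 ->
    measures (fun t => iota1 t + iota2 t);
  tripletsP : forall n0 e iota, triplets (n0, e, iota) ->
    [/\ (0 < n0)%N, sizes e & measures iota];
  triplets_small : forall eps : R, 0 < eps ->
    exists n0 e iota, triplets (n0, e, iota) /\ e n0%:R <= eps }.

Section Estimates.
Context {d : measure_display} {X : measurableType d} {R : realType}.
Variables (mu : probability X R) (T : X -> X).

Definition base_LDT (P : LDT_parameters R) (xi : X -> R) : Prop :=
  mu.-integrable setT (EFin \o xi) /\
  forall eps : R, 0 < eps ->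
    exists n0 e iota, triplets P (n0, e, iota) /\
      forall n : nat, (n0 <= n)%N ->
        e n%:R <= eps /\
        (mu [set x | (e n%:R < `| n%:R^-1 * (\sum_(j < n) xi (iter j T x))
                                 - \int[mu]_y xi y |)%R] < (iota n%:R)%:E)%E.

(* Over the ball of cocycles of radius delta around A and the scales n >= n0,
   the finite scale growth rate is at most b off a set of measure < iota n.
   The second conjunct provides, up to null sets, an exceptional set that does
   not depend on the cocycle B. *)
Definition upper_bound_near (C : cocycle_space mu) m (A : X -> 'M[R]_m)
    (b : \bar R) (delta : R) (n0 : nat) (iota : R -> R) : Prop :=
  (forall (B : X -> 'M[R]_m) n, C m B -> cdist C B A < delta -> (n0 <= n)%N ->
     exists S, [/\ measurable S, (mu S < (iota n%:R)%:E)%E &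
       forall x, ~ S x -> (log_growth T B n x <= b)%E]) /\
  (forall n, (n0 <= n)%N ->
     exists S, [/\ measurable S, (mu S < (iota n%:R)%:E)%E &
       forall B : X -> 'M[R]_m, C m B -> cdist C B A < delta ->
         {ae mu, forall x, ~ S x -> (log_growth T B n x <= b)%E}]).

End Estimates.

(* Main.v *)
(**
   Put g n x = ||A^(n)(x)||.  Fix a real b > L_1(A) and choose a block length p
   with \int (1/p) log g p < b.  The function (1/p) log g p is bounded above by
   a step function s whose steps are superlevel sets of g p, hence belong to the
   algebra F_p(A), with \int s still < b.  As s >= -K is bounded below and
   strictly above the growth of A, it also dominates (1/p) log ||B^(p)|| for
   every B close to A.  Subadditivity, averaged over the p phases, gives
   log ||B^(n)(x)|| <= O(1) + \sum_(j < n) s (T^j x).  Finally s is a constant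
   plus a positive combination of indicators, each of which lies below an
   observable of almost the same mean, so the base-LDT bound this Birkhoff sum
   by n b off a set which depends on A only.  Neither Birkhoff's nor Kingman's
   theorem is needed; the same estimate with B = A, integrated, gives
   L_1(A) = \inf_p \int (1/p) log g p.
*)
Require Import Defs.
From mathcomp Require Import measurable_realfun ess_sup_inf zify ring lra.
Import Order.TTheory GRing.Theory Num.Theory.

Set Implicit Arguments.
Unset Strict Implicit.
Unset Printing Implicit Defensive.

Local Open Scope classical_set_scope.
Local Open Scope ring_scope.

(** * The operator norm *)

Section OperatorNorm.
Context {R : realType}.

(** Lagrange's identity: twice the difference of the two sides is the sum of the squares of
    [a i * b j - a j * b i]. *)
Lemma cauchy_schwarz_sum (I : finType) (a b : I -> R) :
  (\sum_i a i * b i) ^+ 2 <= (\sum_i a i ^+ 2) * (\sum_i b i ^+ 2).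
Proof.
have : 0 <= \sum_i \sum_j (a i * b j - a j * b i) ^+ 2.
  by apply: sumr_ge0 => i _; apply: sumr_ge0 => j _; exact: sqr_ge0.
have -> : \sum_i \sum_j (a i * b j - a j * b i) ^+ 2 =
    \sum_i \sum_j (a i ^+ 2 * b j ^+ 2) + \sum_i \sum_j (b i ^+ 2 * a j ^+ 2)
    - 2 * \sum_i \sum_j ((a i * b i) * (a j * b j)).
  rewrite mulr_sumr -sumrN -!big_split; apply: eq_bigr => i _ /=.
  by rewrite mulr_sumr -sumrN -!big_split; apply: eq_bigr => j _ /=; ring.
by rewrite -!big_distrlr /= -expr2; lra.
Qed.

Section Euclidean.
Variable m : nat.
Implicit Types (u v : 'cV[R]_m) (g h : 'M[R]_m).

Lemma sqr_euclidean_norm v : euclidean_norm v ^+ 2 = \sum_i v i 0 ^+ 2.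
Proof. by rewrite sqr_sqrtr// sumr_ge0// => i _; exact: sqr_ge0. Qed.

Lemma euclidean_norm_ge0 v : 0 <= euclidean_norm v.
Proof. exact: sqrtr_ge0. Qed.

Lemma euclidean_normD u v :
  euclidean_norm (u + v) <= euclidean_norm u + euclidean_norm v.
Proof.
have u0 := euclidean_norm_ge0 u; have v0 := euclidean_norm_ge0 v.
rewrite -ler_sqr ?nnegrE ?addr_ge0 ?euclidean_norm_ge0//.
rewrite sqrrD !sqr_euclidean_norm.
have := cauchy_schwarz_sum (fun i => u i 0) (fun i => v i 0).
rewrite -!sqr_euclidean_norm -exprMn => uv.
have {uv} uv : \sum_i u i 0 * v i 0 <= euclidean_norm u * euclidean_norm v.
  rewrite (le_trans (ler_norm _))// -ler_sqr ?nnegrE ?mulr_ge0//.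
  by rewrite real_normK ?num_real.
rewrite !sqr_euclidean_norm; under eq_bigr do rewrite mxE sqrrD.
by rewrite !big_split/=; lra.
Qed.

Lemma euclidean_normZ (k : R) v :
  euclidean_norm (k *: v) = `|k| * euclidean_norm v.
Proof.
rewrite /euclidean_norm -sqrtr_sqr -sqrtrM ?sqr_ge0// mulr_sumr.
by congr Num.sqrt; apply: eq_bigr => i _; rewrite mxE exprMn.
Qed.

Lemma euclidean_norm0 : euclidean_norm (0 : 'cV[R]_m) = 0.
Proof. by rewrite -(scale0r (0 : 'cV[R]_m)) euclidean_normZ normr0 mul0r. Qed.

Lemma euclidean_norm_eq0 v : euclidean_norm v = 0 -> v = 0.
Proof.
move=> /(congr1 (fun x => x ^+ 2)); rewrite sqr_euclidean_norm expr0n/=.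
move=> /eqP; rewrite psumr_eq0 => [/allP v0|i _]; last exact: sqr_ge0.
apply/colP => i; rewrite mxE; apply/eqP; rewrite -sqrf_eq0.
by apply: v0; rewrite mem_index_enum.
Qed.

(** This crude Frobenius bound shows that the set in the definition of [opnorm] is bounded, so that
    its [sup] is a true supremum and not a default value. *)
Lemma euclidean_norm_mulmx_le_entries g v :
  euclidean_norm (g *m v) <=
    Num.sqrt (\sum_i \sum_j g i j ^+ 2) * euclidean_norm v.
Proof.
rewrite -ler_sqr ?nnegrE ?mulr_ge0 ?sqrtr_ge0// exprMn !sqr_euclidean_norm.
rewrite sqr_sqrtr; last first.
  by apply: sumr_ge0 => i _; apply: sumr_ge0 => j _; exact: sqr_ge0.
rewrite mulr_suml; apply: ler_sum => i _.
by rewrite mxE; exact: cauchy_schwarz_sum.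
Qed.

Lemma opnorm_ub g v : euclidean_norm v <= 1 ->
  euclidean_norm (g *m v) <= opnorm g.
Proof.
move=> v1; apply: ub_le_sup; last by exists v.
exists (Num.sqrt (\sum_i \sum_j g i j ^+ 2)) => _ [w /= w1 <-].
apply: (le_trans (euclidean_norm_mulmx_le_entries _ _)).
by rewrite ler_piMr// sqrtr_ge0.
Qed.

Lemma opnorm_ge0 g : 0 <= opnorm g.
Proof.
rewrite (le_trans (euclidean_norm_ge0 (g *m 0)))// opnorm_ub//.
by rewrite euclidean_norm0.
Qed.

Lemma euclidean_norm_mulmx_le g v :
  euclidean_norm (g *m v) <= opnorm g * euclidean_norm v.
Proof.
have [/euclidean_norm_eq0->|v0] := eqVneq (euclidean_norm v) 0.
  by rewrite mulmx0 euclidean_norm0 mulr0.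
have vp : 0 < euclidean_norm v.
  by rewrite lt_neqAle eq_sym v0 euclidean_norm_ge0.
rewrite -ler_pdivrMr// mulrC.
have -> : (euclidean_norm v)^-1 * euclidean_norm (g *m v) =
          euclidean_norm (g *m ((euclidean_norm v)^-1 *: v)).
  by rewrite -scalemxAr euclidean_normZ gtr0_norm// invr_gt0.
by apply: opnorm_ub; rewrite euclidean_normZ gtr0_norm ?invr_gt0// mulVf.
Qed.

Lemma opnorm_le g (c : R) : 0 <= c ->
  (forall v, euclidean_norm (g *m v) <= c * euclidean_norm v) -> opnorm g <= c.
Proof.
move=> c0 gc; apply: ge_sup.
  by exists (euclidean_norm (g *m 0)), 0 => //=; rewrite euclidean_norm0.
by move=> _ [v /= v1 <-]; rewrite (le_trans (gc v))// ler_piMr//.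
Qed.

Lemma opnormM g h : opnorm (g *m h) <= opnorm g * opnorm h.
Proof.
apply: opnorm_le => [|v]; first by rewrite mulr_ge0 ?opnorm_ge0.
rewrite -mulmxA (le_trans (euclidean_norm_mulmx_le _ _))// -mulrA.
by rewrite ler_wpM2l ?opnorm_ge0// euclidean_norm_mulmx_le.
Qed.

Lemma opnormD g h : opnorm (g + h) <= opnorm g + opnorm h.
Proof.
apply: opnorm_le => [|v]; first by rewrite addr_ge0 ?opnorm_ge0.
rewrite mulmxDl (le_trans (euclidean_normD _ _))// mulrDl.
by rewrite lerD ?euclidean_norm_mulmx_le.
Qed.

Lemma opnorm0 : opnorm (0 : 'M[R]_m) = 0.
Proof.
apply/eqP; rewrite eq_le opnorm_ge0 andbT opnorm_le// => v.
by rewrite mul0mx euclidean_norm0 mul0r.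
Qed.

Lemma opnorm1_le1 : opnorm (1%:M : 'M[R]_m) <= 1.
Proof. by apply: opnorm_le => // v; rewrite mul1mx mul1r. Qed.

Lemma rat_euclidean_dense v (e : R) : 0 < e -> exists w : 'cV[rat]_m,
  euclidean_norm (v - map_mx ratr w) <= e.
Proof.
(* [m.+1] instead of [m] keeps the divisor positive in dimension 0. *)
move=> e0; pose d := e / Num.sqrt m.+1%:R.
have d0 : 0 < d by rewrite divr_gt0// sqrtr_gt0 ltr0n.
have /choice[f fP] (i : 'I_m) : exists q : rat, `|v i 0 - ratr q| <= d.
  have [|q] := @rat_in_itvoo R (v i 0 - d) (v i 0 + d); first by lra.
  by rewrite in_itv/= => /andP[? ?]; exists q; rewrite ler_norml; lra.
exists (\col_i f i); rewrite -ler_sqr ?nnegrE ?euclidean_norm_ge0 ?(ltW e0)//.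
rewrite sqr_euclidean_norm.
apply: (@le_trans _ _ (\sum_(i < m) d ^+ 2)).
  apply: ler_sum => i _; rewrite !mxE -[leLHS]real_normK ?num_real//.
  by rewrite ler_sqr ?nnegrE ?(ltW d0).
rewrite sumr_const card_ord /d exprMn exprVn sqr_sqrtr ?ler0n//.
rewrite -[leLHS]mulr_natr -mulrA ler_piMr ?sqr_ge0//.
by rewrite mulrC ler_pdivrMr ?ltr0n// mul1r ler_nat.
Qed.

(** Reduces a bound on the norm to countably many polynomial inequalities in the entries of [g], as
    measurability requires. These are homogeneous in the vector, so rational vectors need not be
    normalised. *)
Lemma opnorm_leP_rat g (c : R) : 0 <= c ->
  opnorm g <= c <-> forall w : 'cV[rat]_m,
    \sum_i ((g *m map_mx ratr w) i 0) ^+ 2 <=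
    c ^+ 2 * \sum_i (map_mx ratr w : 'cV[R]_m) i 0 ^+ 2.
Proof.
move=> c0; split=> [gc w|gc].
  rewrite -!sqr_euclidean_norm -exprMn.
  rewrite ler_sqr ?nnegrE ?mulr_ge0 ?euclidean_norm_ge0//.
  rewrite (le_trans (euclidean_norm_mulmx_le _ _))// ler_wpM2r//.
  exact: euclidean_norm_ge0.
apply: opnorm_le => // v; apply/ler_addgt0Pr => e e0.
have g0 := opnorm_ge0 g.
(* Replacing [v] by a rational vector at distance r costs at most (||g|| + c) r. The added 1 keeps
   the divisor positive when [g] and [c] vanish. *)
have K0 : 0 < opnorm g + c + 1 by lra.
have [w vw] := rat_euclidean_dense v (divr_gt0 e0 K0).
set u := map_mx ratr w in vw.
have gu : euclidean_norm (g *m u) <= c * euclidean_norm u.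
  rewrite -ler_sqr ?nnegrE ?mulr_ge0 ?euclidean_norm_ge0//.
  by rewrite exprMn !sqr_euclidean_norm gc.
have uv : euclidean_norm u <= euclidean_norm v + euclidean_norm (v - u).
  have -> : euclidean_norm (v - u) = euclidean_norm (u - v).
    by rewrite -opprB -scaleN1r euclidean_normZ normrN1 mul1r.
  by rewrite -{1}(subrKC v u) euclidean_normD.
have : euclidean_norm (g *m v) <=
    euclidean_norm (g *m u) + opnorm g * euclidean_norm (v - u).
  rewrite -{1}(subrKC u v) mulmxDr (le_trans (euclidean_normD _ _))//.
  by rewrite lerD2l euclidean_norm_mulmx_le.
move=> /le_trans; apply.
have cuv := ler_wpM2l c0 uv; rewrite mulrDr in cuv.
rewrite ler_pdivlMr// !mulrDr mulr1 in vw.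
have := euclidean_norm_ge0 (v - u); nra.
Qed.

End Euclidean.
End OperatorNorm.

(** * Measurability and iterates *)

Section Measurability.
Context {d : measure_display} {X : measurableType d} {R : realType}.

Lemma measurable_opnorm m (F : X -> 'M[R]_m) :
  (forall i j, measurable_fun setT (fun x => F x i j)) ->
  measurable_fun setT (fun x => opnorm (F x)).
Proof.
move=> mF; apply: (measurability _ (RGenOInfty.measurableE R)) => //.
move=> _ [_ [c ->] <-]; rewrite setTI.
have -> : (fun x => opnorm (F x)) @^-1` `]c, +oo[ =
    ~` [set x | opnorm (F x) <= c].
  by apply/seteqP; split=> x /=; rewrite in_itv/= andbT ltNge => /negP.
apply: measurableC.
have [c0|c0] := leP 0 c; last first.
  rewrite (_ : [set x | _] = set0)//; apply/seteqP; split=> // x /= xc.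
  by have := opnorm_ge0 (F x); rewrite leNgt (le_lt_trans xc).
have -> : [set x | opnorm (F x) <= c] = ~` \bigcup_(w : 'cV[rat]_m)
    ~` [set x | \sum_i ((F x *m map_mx ratr w) i 0) ^+ 2
         <= c ^+ 2 * \sum_i (map_mx ratr w : 'cV[R]_m) i 0 ^+ 2].
  rewrite setC_bigcup; apply/seteqP; split=> [x /= /opnorm_leP_rat xc w _|x xc].
    by rewrite setCK; exact: xc.
  by apply/opnorm_leP_rat => // w; have := xc w I; rewrite setCK.
apply/measurableC/countable_bigcupT_measurable; first exact: countableP.
move=> w; apply: measurableC; rewrite -[X in measurable X]setTI.
rewrite (_ : [set x | _] = (fun x => \sum_i ((F x *m map_mx ratr w) i 0) ^+ 2)
   @^-1` `]-oo, c ^+ 2 * \sum_i (map_mx ratr w : 'cV[R]_m) i 0 ^+ 2]);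
  last first.
  by apply/seteqP; split=> x /=; rewrite in_itv.
suff : measurable_fun setT (fun x => \sum_i ((F x *m map_mx ratr w) i 0) ^+ 2).
  by apply; [exact: measurableT|exact: measurable_itv].
apply: measurable_sum => i; apply: measurable_funX.
under eq_fun do rewrite mxE.
by apply: measurable_sum => j; exact: measurable_funM.
Qed.

Lemma measurable_lne_EFin (g : X -> R) : measurable_fun setT g ->
  measurable_fun setT (fun x => lne (g x)%:E).
Proof.
move=> mg.
have -> : (fun x => lne (g x)%:E) =
    (fun x => if g x <= 0 then -oo%E else (ln (g x))%:E).
  apply/funext => x; case: leP => gx; first by rewrite le0_lneNy// lee_fin.
  by rewrite lne_EFin.
apply: measurable_fun_ifT.
- exact: measurable_fun_ler.
- exact: measurable_cst.
- by apply/measurable_EFinP; exact: measurableT_comp.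
Qed.

End Measurability.

Section Dynamics.
Context {d : measure_display} {X : measurableType d} {R : realType}.
Variables (mu : probability X R) (T : X -> X).

Lemma measurable_iter n :
  measurable_fun setT T -> measurable_fun setT (iter n T).
Proof.
move=> mT; elim: n => [|n IH]; first exact: measurable_id.
exact: (measurableT_comp mT IH).
Qed.

Lemma iter_preserving n (hT : ergodic_system mu T) (B : set X) : measurable B ->
  mu (iter n T @^-1` B) = mu B.
Proof.
move=> mB; elim: n => // n IH.
rewrite (_ : iter n.+1 T @^-1` B = T @^-1` (iter n T @^-1` B)).
  rewrite (ergodic_preserving hT) ?IH// -[X in measurable X]setTI.
  by apply: measurable_iter => //; exact: ergodic_measurable hT.
by apply/seteqP; split=> x /=; rewrite -iterS iterSr.
Qed.

(** The preimages of a null set under the iterates are null by invariance, and there are countably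
    many. This turns almost sure bounds into bounds along whole orbits. *)
Lemma ae_iter (hT : ergodic_system mu T) (Q : X -> Prop) :
  {ae mu, forall x, Q x} -> {ae mu, forall x, forall j, Q (iter j T x)}.
Proof.
move=> [N [mN N0 QN]]; apply: ae_foralln => j.
exists (iter j T @^-1` N); split.
- rewrite -[X in measurable X]setTI.
  by apply: measurable_iter => //; exact: ergodic_measurable hT.
- exact: etrans (iter_preserving j hT mN) N0.
- by move=> x /= nQ; exact: QN.
Qed.

Section Cocycle.
Variables (m : nat).
Implicit Types A B : X -> 'M[R]_m.

Lemma iterateD A a b x :
  iterate T A (a + b) x = iterate T A a (iter b T x) *m iterate T A b x.
Proof.
by elim: a => [|a IH]; rewrite ?mul1mx// addSn /= IH iterD mulmxA.
Qed.

Lemma measurable_opnorm_iterate A n : measurable_fun setT T ->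
  (forall i j, measurable_fun setT (fun x => A x i j)) ->
  measurable_fun setT (fun x => opnorm (iterate T A n x)).
Proof.
move=> mT mA; apply: measurable_opnorm; elim: n => [|n IH] i j /=.
  exact: measurable_cst.
under eq_fun do rewrite mxE.
apply: measurable_sum => k; apply: measurable_funM => //.
exact: (measurableT_comp (mA i k) (measurable_iter n mT)).
Qed.

Lemma measurable_log_growth A n : measurable_fun setT T ->
  (forall i j, measurable_fun setT (fun x => A x i j)) ->
  measurable_fun setT (log_growth T A n).
Proof.
move=> mT mA; apply: measurable_funeM; apply: measurable_lne_EFin.
exact: measurable_opnorm_iterate.
Qed.

Lemma opnorm_iterateD A a b x : opnorm (iterate T A (a + b) x) <=
  opnorm (iterate T A a (iter b T x)) * opnorm (iterate T A b x).
Proof. by rewrite iterateD opnormM. Qed.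

Lemma opnorm_iterate_le A (c : R) n x :
  (forall j, opnorm (A (iter j T x)) <= c) ->
  opnorm (iterate T A n x) <= c ^+ n.
Proof.
move=> Ac; elim: n => [|n IH] /=; first exact: opnorm1_le1.
rewrite (le_trans (opnormM _ _))// exprS ler_pM// opnorm_ge0//.
Qed.

(** Induction on b p - a q = b (p - q) + (b - a) q. The exponent n - 1 is relaxed to n, which
    [1 <= c] permits. *)
Lemma opnorm_iterateB A B (c e : R) n x : 1 <= c -> 0 <= e ->
  (forall j, opnorm (A (iter j T x)) <= c) ->
  (forall j, opnorm (B (iter j T x)) <= c) ->
  (forall j, opnorm (B (iter j T x) - A (iter j T x)) <= e) ->
  opnorm (iterate T B n x - iterate T A n x) <= n%:R * e * c ^+ n.
Proof.
move=> c1 e0 Ac Bc BA; have c0 : 0 <= c by lra.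
elim: n => [|n IH] /=; first by rewrite subrr opnorm0 !mul0r.
set a := A _; set b := B _; set p := iterate T B n x; set q := iterate T A n x.
have -> : b *m p - a *m q = b *m (p - q) + (b - a) *m q.
  by rewrite mulmxBr mulmxBl addrA subrK.
rewrite (le_trans (opnormD _ _))//.
have h1 : opnorm (b *m (p - q)) <= c * (n%:R * e * c ^+ n).
  by rewrite (le_trans (opnormM _ _))// ler_pM ?opnorm_ge0// Bc.
have h2 : opnorm ((b - a) *m q) <= e * c ^+ n.
  rewrite (le_trans (opnormM _ _))// ler_pM ?opnorm_ge0// ?BA//.
  exact: opnorm_iterate_le.
rewrite (le_trans (lerD h1 h2))// exprS -natr1.
have : e * c ^+ n * 1 <= e * c ^+ n * c.
  by rewrite ler_wpM2l// mulr_ge0// exprn_ge0.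
lra.
Qed.

(** Growth is estimated on norms, in exponential form, which stays meaningful when the product
    vanishes and its logarithm is -oo. At scale 0 the factor [n%:R^-1] is 0, hence the condition on
    [n]. *)
Lemma log_growth_le A n x (b : R) : (0 < n)%N ->
  opnorm (iterate T A n x) <= expR (n%:R * b) -> (log_growth T A n x <= b%:E)%E.
Proof.
move=> n0 gb; rewrite /log_growth.
have n0' : 0 < n%:R :> R by rewrite ltr0n.
have [g0|g0] := leP (opnorm (iterate T A n x)) 0.
  by rewrite le0_lneNy ?lee_fin// gt0_muleNy ?lte_fin ?invr_gt0// leNye.
rewrite lne_EFin// -EFinM lee_fin mulrC ler_pdivrMr// mulrC.
by rewrite -ler_expR lnK.
Qed.

Lemma log_growth_leP A n x (b : R) : (0 < n)%N ->
  (log_growth T A n x <= b%:E)%E -> opnorm (iterate T A n x) <= expR (n%:R * b).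
Proof.
move=> n0; rewrite /log_growth.
have n0' : 0 < n%:R :> R by rewrite ltr0n.
have [g0 _|g0] := leP (opnorm (iterate T A n x)) 0.
  by rewrite (le_trans g0)// expR_ge0.
rewrite lne_EFin// -EFinM lee_fin mulrC ler_pdivrMr// mulrC.
by move=> gb; rewrite -[leLHS]lnK// ler_expR.
Qed.

End Cocycle.
End Dynamics.

(** * Block estimate *)

Section BlockEstimate.
Context {d : measure_display} {X : measurableType d} {R : realType}.
Variables (T : X -> X) (m : nat) (A : X -> 'M[R]_m) (s : X -> R) (c : R).
Variables (p : nat) (x : X).
Hypotheses (p0 : (0 < p)%N) (c1 : 1 <= c).
Hypothesis Ac : forall j, opnorm (A (iter j T x)) <= c.
Hypothesis As : forall j, opnorm (iterate T A p (iter j T x)) <=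
  expR (p%:R * s (iter j T x)).

Local Notation g k := (opnorm (iterate T A k x)).

Let Ac_iter k j : opnorm (A (iter j T (iter k T x))) <= c.
Proof. by rewrite -iterD. Qed.

(* Averaging over the p phases makes the sum of the block bounds telescope:
   P (n + 1) <= P n * exp (p s (T^n x)) for P n = \prod_(r < p) g (n + r). *)
Lemma prod_opnorm_iterate_le n : \prod_(r < p) g (n + r)%N <=
  c ^+ (p * p) * expR (p%:R * \sum_(j < n) s (iter j T x)).
Proof.
have c0 : 0 <= c by exact: le_trans ler01 c1.
elim: n => [|n IH].
  rewrite big_ord0 mulr0 expR0 mulr1.
  apply: (@le_trans _ _ (\prod_(r < p) c ^+ p)).
    apply: ler_prod => r _; rewrite opnorm_ge0/=.
    by rewrite (le_trans (opnorm_iterate_le _ Ac))// ler_weXn2l// add0n ltnW.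
  by rewrite prodr_const card_ord exprM.
apply: (@le_trans _ _
    ((\prod_(r < p) g (n + r)%N) * expR (p%:R * s (iter n T x)))).
  have gnp : g (p + n) <= expR (p%:R * s (iter n T x)) * g n.
    by rewrite (le_trans (opnorm_iterateD _ _ _ _ _))// ler_wpM2r ?opnorm_ge0.
  case: p p0 gnp => // q _ gnp.
  rewrite big_ord_recr big_ord_recl /= addn0.
  have -> : \prod_(i < q) g (n.+1 + i)%N = \prod_(i < q) g (n + bump 0 i)%N.
    by apply: eq_bigr => i _; rewrite addSnnS.
  set Q := \prod_(i < q) _.
  have -> : g n * Q * expR (q.+1%:R * s (iter n T x)) =
    Q * (expR (q.+1%:R * s (iter n T x)) * g n) by ring.
  rewrite ler_wpM2l//; first by apply: prodr_ge0 => i _; exact: opnorm_ge0.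
  by move: gnp; rewrite (_ : q.+1 + n = n.+1 + q)%N //; lia.
rewrite big_ord_recr mulrDr expRD mulrA ler_wpM2r// expR_ge0//.
Qed.

(** For each r < p, g (n + p) <= c^p g (n + r). Multiplying over r bounds the p-th power of g (n +
    p) by c^(p * p) times the product above; then the p-th root is taken. *)
Lemma opnorm_iterate_block n : g (n + p)%N <=
  c ^+ (2 * p) * expR (\sum_(j < n) s (iter j T x)).
Proof.
have c0 : 0 <= c by exact: le_trans ler01 c1.
rewrite -(@ler_pXn2r _ p)// ?nnegrE ?opnorm_ge0 ?mulr_ge0 ?exprn_ge0
  ?expR_ge0//.
rewrite exprMn -expRM_natl -exprM -mulnA mul2n -addnn exprD -mulrA.
apply: (@le_trans _ _ (\prod_(r < p) (c ^+ p * g (n + r)%N))); last first.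
  rewrite big_split /= prodr_const card_ord -exprM ler_wpM2l ?exprn_ge0//.
  exact: prod_opnorm_iterate_le.
rewrite -[X in _ ^+ X](card_ord p) -prodr_const.
apply: ler_prod => r _; rewrite opnorm_ge0/=.
have -> : (n + p = (p - r) + (n + r))%N by have := ltn_ord r; lia.
rewrite (le_trans (opnorm_iterateD _ _ _ _ _))// ler_wpM2r ?opnorm_ge0//.
rewrite (le_trans (opnorm_iterate_le _ (Ac_iter _)))// ler_weXn2l// leq_subr//.
Qed.

(** The block bound at [n - p] involves only the first [n - p] terms. Each of the last [p] terms is
    at least [- K], so they may be added at the cost of [K *+ p]. *)
Lemma opnorm_iterate_sum (K : R) n : (forall j, - K <= s (iter j T x)) ->
  (p <= n)%N ->
  g n <= expR (ln c *+ (2 * p) + K *+ p + \sum_(j < n) s (iter j T x)).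
Proof.
move=> sK pn; have c0 : 0 < c by exact: lt_le_trans ltr01 c1.
rewrite -(subnK pn); move: (n - p)%N => k.
rewrite (le_trans (opnorm_iterate_block _))// -addrA expRD.
rewrite -mulr_natl expRM_natl lnK ?posrE//.
rewrite ler_wpM2l ?exprn_ge0 ?ler_expR// ?(ltW c0)//.
rewrite big_split_ord /= addrCA lerDl -[p in K *+ p]card_ord -sumr_const.
by rewrite -big_split sumr_ge0//= => i _; have := sK (k + i)%N; lra.
Qed.

End BlockEstimate.

(** * Step functions above a function *)

Section Integrals.
Context {d : measure_display} {X : measurableType d} {R : realType}.
Variable mu : probability X R.

Lemma integral_cst_probability (r : \bar R) : (\int[mu]_x cst r x)%E = r.
Proof.
by rewrite integral_cst// [X in (_ * X)%E](probability_setT mu) mule1.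
Qed.

(** Either integral may be infinite, so positive and negative parts are compared separately. *)
Lemma ae_le_integral (f g : X -> \bar R) :
  measurable_fun setT f -> measurable_fun setT g ->
  {ae mu, forall x, (f x <= g x)%E} ->
  (\int[mu]_x f x <= \int[mu]_x g x)%E.
Proof.
move=> mf mg fg; rewrite integralE [leRHS]integralE; apply: leeB.
- apply: ae_ge0_le_integral => //; [exact: measurable_funepos..|].
  apply: filterS fg => x fgx _; rewrite !funeposE ge_max !le_max fgx/= lexx.
  by rewrite orbT.
- apply: ae_ge0_le_integral => //; [exact: measurable_funeneg..|].
  apply: filterS fg => x fgx _.
  by rewrite !funenegE ge_max !le_max leeN2 fgx/= lexx orbT.
Qed.

(** [S] counts the grid points h, 2h, ..., qh up to [t]: it is the integer part of t^+ / h, cut off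
    at [q]. *)
Lemma staircase (t : \bar R) (h : R) q : 0 < h ->
  let S := (\sum_(i < q) ((h *+ i.+1)%:E <= t)%E)%N in
  [/\ ((h *+ S)%:E <= maxe t 0)%E, (S <= q)%N &
      ((S < q)%N -> t <= (h *+ S.+1)%:E)%E].
Proof.
move=> h0; elim: q => [|q] /=.
  by rewrite big_ord0 mulr0n; split=> //; rewrite le_max lexx orbT.
rewrite big_ord_recr /=; set S := (\sum_(i < q) _)%N => -[S1 S2 S3].
have [qt|tq] := leP (h *+ q.+1)%:E t; last first.
  rewrite addn0; split=> [//||]; first exact: leq_trans S2 _.
  rewrite ltnS leq_eqVlt => /orP[/eqP->|]; last exact: S3.
  exact: ltW.
have Sq : S = q.
  apply/eqP; rewrite eqn_leq S2 leqNgt; apply/negP => Sq.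
  by have := le_trans qt (S3 Sq); rewrite lee_fin ler_pMn2l// ltnS leqNgt Sq.
by rewrite Sq addn1; split=> //; rewrite ?ltnn// le_max qt.
Qed.

Variables (f : X -> \bar R) (M : R).
Hypothesis mf : measurable_fun setT f.
Hypothesis fM : {ae mu, forall x, (f x <= M%:E)%E}.

Definition superlevel (K h : R) (i : nat) :=
  [set x | ((- K + h *+ i.+1)%:E <= f x)%E].

Lemma measurable_superlevel K h i : measurable (superlevel K h i).
Proof.
rewrite -[superlevel _ _ _]setTI.
exact: emeasurable_fun_c_infty.
Qed.

(* Between the levels - K and - K + h (q + 1) this is f cut off below at - K,
   rounded up to the grid - K + h Z, plus h. *)
Definition step_fun (K h : R) (q : nat) (x : X) : R :=
  - K + h *+ 2 + h * \sum_(i < q) \1_(superlevel K h i) x.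

Lemma step_funE K h q x : step_fun K h q x = - K + h *+ 2 +
  h *+ (\sum_(i < q) ((h *+ i.+1)%:E <= f x + K%:E)%E).
Proof.
rewrite /step_fun -(mulr_natr h (\sum_(i < q) _)%N) natr_sum.
congr (_ + _ * _); apply: eq_bigr => i _.
rewrite indicE; congr (nat_of_bool _)%:R.
rewrite -leeBlDr// -EFinB addrC.
by apply/idP/idP => [/set_mem|] //; exact: mem_set.
Qed.

Lemma step_fun_ge K h q x : 0 < h -> - K <= step_fun K h q x.
Proof.
move=> h0; rewrite step_funE -addrA lerDl addr_ge0// mulrn_wge0// ltW//.
Qed.

(** The grid reaches past the essential bound [M], so cutting the count off at [q] is harmless. The
    margin [h] left here later absorbs the passage from [A] to a nearby cocycle. *)
Lemma le_step_fun K h q : 0 < h -> M + K < h *+ q.+1 ->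
  {ae mu, forall x, (f x <= (step_fun K h q x - h)%:E)%E}.
Proof.
move=> h0 Mq; apply: filterS fM => x fx; rewrite step_funE.
have [_ + +] := staircase (f x + K%:E)%E q h0.
move: (\sum_(i < q) _)%N => S Sq fS.
have : (f x + K%:E <= (h *+ S.+1)%:E)%E.
  move: Sq; rewrite leq_eqVlt => /orP[/eqP->|//].
  apply: (@le_trans _ _ (M + K)%:E); last by rewrite lee_fin ltW.
  by rewrite EFinD; exact: leeD2r.
rewrite -leeBrDr// => /le_trans; apply.
by rewrite -EFinB lee_fin mulrS mulr2n; lra.
Qed.

Lemma integral_funepos_fin_num : (\int[mu]_x f^\+ x)%E \is a fin_num.
Proof.
rewrite ge0_fin_numE; last by apply: integral_ge0.
apply: (@le_lt_trans _ _ (\int[mu]_x (Num.max M 0)%:E)%E).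
  apply: ae_ge0_le_integral => //; first exact: measurable_funepos.
  - by move=> x _; rewrite lee_fin le_max lexx orbT.
  - apply: filterS fM => x fx _.
    by rewrite funeposE EFin_max ge_max !le_max fx lexx orbT.
by rewrite integral_cst_probability ltry.
Qed.

Lemma limn_mine_nat (t : \bar R) : (0 <= t)%E ->
  limn (fun n => mine t n%:R%:E) = t.
Proof.
case: t => [r r0| _|//].
- apply/cvg_lim => //; apply: cvg_near_cst.
  exists (Num.bound r) => // n /= rn; apply/eqP; rewrite eq_minl// lee_fin.
  by rewrite (le_trans (ltW (archi_boundP r0)))// ler_nat.
- under eq_fun do rewrite minye.
  by apply/cvg_lim => //; apply/cvgeryP; exact: cvgr_idn.
Qed.

(** By monotone convergence, a finite truncation of the negative part already brings the mean below
    [b]. This covers a mean equal to -oo. *)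
Lemma truncation_integral_lt (b : R) : (\int[mu]_x f x < b%:E)%E ->
  exists (k : nat) (b0 : R), b0 < b /\
    (\int[mu]_x f^\+ x <= b0%:E + \int[mu]_x mine (f^\- x) k%:R%:E)%E.
Proof.
move=> fb.
have [b0 fb0 b0b] : exists2 b0 : R, (\int[mu]_x f x < b0%:E)%E & b0 < b.
  move: fb; case: (\int[mu]_x f x)%E => [r|//|_].
    by rewrite lte_fin => rb; exists ((r + b) / 2); rewrite ?lte_fin; lra.
  by exists (b - 1); [rewrite ltNyr|lra].
suff [k kP] : exists k : nat,
    (\int[mu]_x f^\+ x <= b0%:E + \int[mu]_x mine (f^\- x) k%:R%:E)%E.
  by exists k, b0.
(* If every [k] failed, letting k tend to infinity would give \int f^- <= \int f^+ - b0, hence \int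
   f >= b0, against the choice of [b0]. *)
apply: contrapT => /forallNP nk.
have P_fin := integral_funepos_fin_num.
have : (\int[mu]_x f^\- x <= \int[mu]_x f^\+ x - b0%:E)%E.
  have mono : (\int[mu]_x mine (f^\- x) n%:R%:E)%E @[n --> \oo] -->
      (\int[mu]_x f^\- x)%E.
    under [X in _ --> X]eq_integral => x _.
      rewrite -[(f^\- x)%E]limn_mine_nat//; over.
    apply: cvg_monotone_convergence => //.
    - move=> n; apply: measurable_mine; last exact: measurable_cst.
      exact: measurable_funeneg.
    - by move=> n x _; rewrite le_min funeneg_ge0 lee_fin ler0n.
    - move=> x _ n1 n2 n12; rewrite le_min !ge_min lexx/=.
      by rewrite lee_fin ler_nat n12 orbT.
  rewrite -(cvg_lim _ mono)//; apply: lime_le.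
    by apply/cvg_ex; eexists; exact: mono.
  apply: nearW => n; rewrite leeBrDr// addeC.
  by have /negP := nk n; rewrite -ltNge => /ltW.
apply/negP; rewrite -ltNge; move: fb0; rewrite integralE.
move: (\int[mu]_x f^\- x)%E P_fin; move: (\int[mu]_x f^\+ x)%E => [p|//|//].
move=> [r _|_ _|//]; last by rewrite ltry.
by rewrite -!EFinB !lte_fin; lra.
Qed.

(** Pointwise, h S <= max (f + k, 0) = f^+ - min (f^-, k) + k with S the count of [staircase]. The
    negative term is moved to the left so that only nonnegative functions are integrated. *)
Lemma step_integral_le (k : nat) (h : R) q : 0 < h ->
  (h%:E * (\sum_(i < q) mu (superlevel k%:R h i)) +
     \int[mu]_x mine (f^\- x) k%:R%:E <=
   \int[mu]_x f^\+ x + k%:R%:E)%E.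
Proof.
move=> h0.
have mF i : measurable (superlevel k%:R h i) by exact: measurable_superlevel.
have mI : measurable_fun setT
    (fun x => \sum_(i < q) (\1_(superlevel k%:R h i) x : R)%:E)%E.
  under eq_fun do rewrite sumEFin; apply/measurable_EFinP.
  by apply: measurable_sum => i; exact: measurable_indic.
have -> : (\sum_(i < q) mu (superlevel k%:R h i) =
    \int[mu]_x \sum_(i < q) (\1_(superlevel k%:R h i) x : R)%:E)%E.
  rewrite ge0_integral_sum//=.
    by apply: eq_bigr => i _; rewrite integral_indic// setIT.
  by move=> i; apply/measurable_EFinP; exact: measurable_indic.
rewrite -[X in (_ <= _ + X)%E](integral_cst_probability (k%:R%:E)).
rewrite -ge0_integralZl_EFin//; last 2 first.
- by move=> x _; apply: sume_ge0 => i _; rewrite lee_fin.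
- exact: ltW.
have m1 : measurable_fun setT
    (fun x => h%:E * \sum_(i < q) (\1_(superlevel k%:R h i) x : R)%:E)%E.
  exact: measurable_funeM.
have m2 : measurable_fun setT (fun x => mine (f^\- x) (k%:R%:E))%E.
  by apply: measurable_mine; [exact: measurable_funeneg|exact: measurable_cst].
have p1 x : setT x ->
    (0 <= h%:E * \sum_(i < q) (\1_(superlevel k%:R h i) x : R)%:E)%E.
  move=> _; apply: mule_ge0; first by rewrite lee_fin ltW.
  by apply: sume_ge0 => i _; rewrite lee_fin.
have p2 x : setT x -> (0 <= mine (f^\- x) (k%:R%:E))%E.
  by move=> _; rewrite le_min funeneg_ge0 lee_fin ler0n.
rewrite -!ge0_integralD//; last 2 first.
- exact: measurable_funepos.
- by move=> x _; rewrite lee_fin.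
apply: ge0_le_integral => //.
- by move=> x _; rewrite adde_ge0 ?p1 ?p2.
- exact: emeasurable_funD.
- by apply: emeasurable_funD => //; exact: measurable_funepos.
move=> x _; rewrite sumEFin -EFinM.
have := step_funE k%:R h q x; rewrite /step_fun => /addrI ->.
have [+ _ _] := staircase (f x + k%:R%:E)%E q h0.
move: (\sum_(i < q) _)%N => S; rewrite funeposE funenegE /=.
have k0 : 0 <= k%:R :> R by exact: ler0n.
case: (f x) => [r||] /=.
- rewrite -!EFin_max -EFin_min -!EFinD !lee_fin.
  case: (leP r 0); case: (leP (- r) 0); case: leP;
    by rewrite ?maxEle ?minEle; do ?case: ifP; lra.
- by move=> _; rewrite maxye addye// leey.
- by rewrite addNye !maxNye maxye minye add0e -!EFinD !lee_fin; lra.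
Qed.

(** The five [h] are a budget: one for rounding up to the grid, one for perturbing the cocycle, one
    for the means of the observables, one for their deviations and one for the boundary term of the
    block estimate. *)
Lemma step_integral_lt (b : R) : (\int[mu]_x f x < b%:E)%E ->
  exists (K h : R) (q : nat), [/\ 0 < h, (0 < q)%N, M + K < h *+ q.+1 &
    (h%:E * (\sum_(i < q) mu (superlevel K h i)) <= (b + K - h *+ 5)%:E)%E].
Proof.
move=> /truncation_integral_lt[k [b0 [b0b kP]]].
pose h := (b - b0) / 5; have h0 : 0 < h by rewrite /h; lra.
(* The archimedean bound takes the grid past [M]; the successor makes [q] positive. *)
exists k%:R, h, (Num.bound `|(M + k%:R) / h|).+1; split=> //.
  rewrite -[ltRHS]mulr_natl -ltr_pdivrMr// (le_lt_trans (ler_norm _))//.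
  by rewrite (lt_trans (archi_boundP _))// ltr_nat.
(* The truncated integral is at most [k], hence finite, and can be cancelled. *)
have I_fin : (\int[mu]_x mine (f^\- x) k%:R%:E)%E \is a fin_num.
  rewrite ge0_fin_numE; last first.
    by apply: integral_ge0 => x _; rewrite le_min funeneg_ge0 lee_fin ler0n.
  apply: (@le_lt_trans _ _ (\int[mu]_x (cst k%:R%:E x))%E).
    apply: ge0_le_integral => //.
    + by move=> x _; rewrite le_min funeneg_ge0 lee_fin ler0n.
    + apply: measurable_mine; last exact: measurable_cst.
      exact: measurable_funeneg.
    + by move=> x _; rewrite ge_min lexx orbT.
  by rewrite integral_cst_probability ltry.
have := le_trans (step_integral_le k _ h0) (leeD2r k%:R%:E kP).
move: I_fin; case: (\int[mu]_x _)%E => [I _|//|//].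
move=> /(_ (Num.bound `|(M + k%:R) / h|).+1).
rewrite -leeBrDr// => /le_trans; apply.
rewrite -!EFinD lee_fin -mulr_natl /h; lra.
Qed.

End Integrals.

(** * The top Lyapunov exponent as an infimum *)

Section EventualInfimum.
Context {R : realType}.

Lemma ereal_dense_EFin (x y : \bar R) : (x < y)%E ->
  exists r : R, (x < r%:E < y)%E.
Proof.
case: x => [x||]; case: y => [y||] // xy.
- exists ((x + y) / 2); rewrite !lte_fin; move: xy; rewrite lte_fin; lra.
- by exists (x + 1); rewrite lte_fin ltry; lra.
- by exists (y - 1); rewrite lte_fin ltNyr; lra.
- by exists 0; rewrite ltNyr ltry.
Qed.

(** The hypothesis bounds the upper limit by the infimum, which is below every term of positive
    index. The sequence is shifted by one because the infimum leaves out index 0. *)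
Lemma limn_ereal_inf (a : nat -> \bar R) :
  (forall p (b : R), (0 < p)%N -> (a p < b%:E)%E ->
     \forall n \near \oo, (a n <= b%:E)%E) ->
  limn a = ereal_inf [set a p | p in [set p | (0 < p)%N]].
Proof.
move=> ab; apply/cvg_lim => //; rewrite -cvg_shiftS.
apply: limn_esup_le_cvg => [|n]; last by apply: ereal_inf_lbound; exists n.+1.
rewrite leNgt; apply/negP => /ereal_inf_lt[_ [p /= p0 <-]] /ereal_dense_EFin[b].
move=> /andP[/(ab _ _ p0)[N _ Nb]]; apply/negP; rewrite -leNgt.
apply: (@le_trans _ _ (ereal_sup [set a n.+1 | n in [set n | (N <= n)%N]])).
  apply: ereal_inf_lbound; exists [set n | (N <= n)%N] => //.
  by exists N.
apply: ge_ereal_sup => _ [n /= Nn <-]; apply: Nb => /=.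
exact: leq_trans Nn _.
Qed.

End EventualInfimum.

Section Growth.
Context {d : measure_display} {X : measurableType d} {R : realType}.
Variables (mu : probability X R) (T : X -> X).
Hypothesis hT : ergodic_system mu T.

Lemma sum_measure_fine (F : nat -> set X) q : (forall i, measurable (F i)) ->
  (\sum_(i < q) mu (F i))%E = (\sum_(i < q) fine (mu (F i)))%:E.
Proof.
move=> mF; rewrite -sumEFin; apply: eq_bigr => i _.
by rewrite fineK// fin_num_measure.
Qed.

Lemma norm_Linfty_ae m (A : X -> 'M[R]_m) (c : R) :
  (norm_Linfty mu A <= c%:E)%E -> {ae mu, forall x, opnorm (A x) <= c}.
Proof.
rewrite /norm_Linfty unlock /= ifT; last first.
  by rewrite [X in (_ < X)%E](probability_setT mu) lte_fin.
move=> /ess_supP; apply: filterS => x /=; rewrite lee_fin.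
by rewrite ger0_norm// opnorm_ge0.
Qed.

Section StepFunIterates.
Variables (f : X -> \bar R) (mf : measurable_fun setT f) (K h : R) (q : nat).

Lemma step_fun_iterE j x : (step_fun f K h q (iter j T x))%:E =
  ((- K + h *+ 2)%:E +
   h%:E * \sum_(i < q) (\1_(iter j T @^-1` superlevel f K h i) x : R)%:E)%E.
Proof. by rewrite sumEFin -EFinM -EFinD. Qed.

Let mF j i : measurable (iter j T @^-1` superlevel f K h i).
Proof.
rewrite -[X in measurable X]setTI.
apply: measurable_iter => //; first exact: ergodic_measurable hT.
exact: measurable_superlevel.
Qed.

Let integrable_sum_indic j : mu.-integrable setT
  (fun x => \sum_(i < q) (\1_(iter j T @^-1` superlevel f K h i) x : R)%:E)%E.
Proof. by apply: integrable_sum => // i _; exact: integrable_indic. Qed.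

Lemma integrable_step_fun_iter j :
  mu.-integrable setT (fun x => (step_fun f K h q (iter j T x))%:E).
Proof.
under eq_fun do rewrite step_fun_iterE.
apply: integrableD => //; first exact: finite_measure_integrable_cst.
exact: integrableZl.
Qed.

Lemma integral_step_fun_iter j :
  (\int[mu]_x (step_fun f K h q (iter j T x))%:E)%E =
  ((- K + h *+ 2)%:E + h%:E * \sum_(i < q) mu (superlevel f K h i))%E.
Proof.
under eq_integral do rewrite step_fun_iterE.
rewrite integralD//=; first last.
- exact: integrableZl.
- exact: finite_measure_integrable_cst.
rewrite (integral_cst_probability mu (- K + h *+ 2)%:E).
rewrite integralZl// integral_sum//; last by move=> i; exact: integrable_indic.
congr (_ + _ * _)%E; apply: eq_bigr => i _.
rewrite integral_indic// setIT.
exact: (iter_preserving _ hT (measurable_superlevel mf _ _ _)).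
Qed.

End StepFunIterates.

Variables (m : nat) (A : X -> 'M[R]_m) (c : R).
Hypothesis mA : forall i j, measurable_fun setT (fun x => A x i j).
Hypothesis c1 : 1 <= c.
Hypothesis Ac : {ae mu, forall x, opnorm (A x) <= c}.

Let mT : measurable_fun setT T. Proof. exact: ergodic_measurable hT. Qed.

Lemma log_growth_ub_ae p : (0 < p)%N ->
  {ae mu, forall x, (log_growth T A p x <= (ln c)%:E)%E}.
Proof.
move=> p0; apply: filterS (ae_iter hT Ac) => x Acx; apply: log_growth_le => //.
rewrite expRM_natl lnK ?posrE; last exact: lt_le_trans ltr01 c1.
exact: opnorm_iterate_le.
Qed.

(** All step functions along the orbit have the same mean, at most b - 3h, and the boundary term [D]
    contributes at most [h] after division by [n]. This plays the part of Fekete's lemma and allows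
    integrals equal to -oo. *)
Lemma integral_log_growth_eventually_le p (b : R) : (0 < p)%N ->
  (\int[mu]_x log_growth T A p x < b%:E)%E ->
  \forall n \near \oo, (\int[mu]_x log_growth T A n x <= b%:E)%E.
Proof.
move=> p0.
have mf := measurable_log_growth p mT mA.
have fc := log_growth_ub_ae p0.
move=> /(step_integral_lt mf fc)[K [h [q [h0 q0 cq]]]].
set f := log_growth T A p in mf fc cq *; set I := (\sum_(i < q) _)%E => hI.
pose D := ln c *+ (2 * p) + K *+ p.
exists (maxn p.+1 (Num.bound `|D / h|)) => // n /=.
rewrite geq_max => /andP[pn Dn].
have n0 : 0 < n%:R :> R by rewrite ltr0n (leq_ltn_trans _ pn).
pose g x := ((n%:R^-1 * D)%:E + n%:R^-1%:E *
  \sum_(j < n) (step_fun f K h q (iter j T x))%:E)%E.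
have gi : mu.-integrable setT (fun x => n%:R^-1%:E *
    \sum_(j < n) (step_fun f K h q (iter j T x))%:E)%E.
  by apply: integrableZl => //; apply: integrable_sum => // j _;
    exact: integrable_step_fun_iter.
have ci : mu.-integrable setT (cst (n%:R^-1 * D)%:E).
  exact: finite_measure_integrable_cst.
apply: (@le_trans _ _ (\int[mu]_x g x)%E).
  apply: ae_le_integral; first exact: measurable_log_growth.
    by case/integrableP: (integrableD measurableT ci gi).
  have /(ae_iter hT) := le_step_fun fc h0 cq.
  apply: filterS2 (ae_iter hT Ac) => x Acx fx.
  rewrite /g sumEFin -EFinM -EFinD -mulrDr.
  apply: log_growth_le; first by rewrite -(ltr_nat R).
  rewrite mulrA mulfV ?gt_eqF// mul1r.
  apply: (opnorm_iterate_sum p0 c1 Acx) => [j|j|]; last exact: ltnW.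
    apply: log_growth_leP => //; apply: le_trans (fx j) _.
    by rewrite lee_fin; lra.
  exact: step_fun_ge.
rewrite /g integralD// integralZl//; last first.
  by apply: integrable_sum => // j _; exact: integrable_step_fun_iter.
rewrite integral_cst_probability integral_sum//; last first.
  by move=> j; exact: integrable_step_fun_iter.
under eq_bigr do rewrite integral_step_fun_iter//.
move: hI; rewrite -/I /I sum_measure_fine; last first.
  by move=> i; exact: measurable_superlevel.
move: (\sum_(i < q) _) => S; rewrite -EFinM lee_fin => hS.
rewrite -EFinD sumEFin -EFinM -EFinD lee_fin sumr_const card_ord.
set J := - K + h *+ 2 + h * S.
have -> : n%:R^-1 * (J *+ n) = J.
  by rewrite -(mulr_natl J) mulrA mulVf ?gt_eqF// mul1r.
have : n%:R^-1 * D <= h.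
  rewrite mulrC ler_pdivrMr// -ler_pdivrMl// mulrC.
  rewrite (le_trans (ler_norm _))// (le_trans (ltW (archi_boundP _)))//.
  by rewrite ler_nat.
rewrite /J; lra.
Qed.

Lemma lyapunov1E : lyapunov1 mu T A = ereal_inf
  [set (\int[mu]_x log_growth T A p x)%E | p in [set p | (0 < p)%N]].
Proof.
by apply: limn_ereal_inf => p b p0; exact: integral_log_growth_eventually_le.
Qed.

Lemma lyapunov1_lty : (lyapunov1 mu T A < +oo)%E.
Proof.
rewrite lyapunov1E.
apply: (@le_lt_trans _ _ (\int[mu]_x log_growth T A 1 x)%E).
  by apply: ereal_inf_lbound; exists 1%N.
apply: (@le_lt_trans _ _ (ln c)%:E); last exact: ltry.
rewrite -(integral_cst_probability mu (ln c)%:E).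
apply: ae_le_integral; first exact: measurable_log_growth.
  exact: measurable_cst.
exact: log_growth_ub_ae.
Qed.

End Growth.

(** * Uniform upper bounds *)

(** [0 < q] excludes the empty sum: the zero function is not positive, so it is no deviation
    measure. *)
Lemma measures_sum (R : realType) (P : LDT_parameters R) (q : nat)
    (iota : nat -> R -> R) : (0 < q)%N -> (forall i, measures P (iota i)) ->
  measures P (fun t => \sum_(i < q) iota i t).
Proof.
move=> + mi; elim: q => // -[|q] IH _.
  by under eq_fun do rewrite big_ord_recr big_ord0 /= add0r.
under eq_fun do rewrite big_ord_recr.
by apply: measuresD => //; exact: IH.
Qed.

Lemma lte_sum_EFin (R : realType) (a : nat -> \bar R) (r : nat -> R) (q : nat) :
  (0 < q)%N -> (forall i, (i < q)%N -> (a i < (r i)%:E)%E) ->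
  (\sum_(i < q) a i < (\sum_(i < q) r i)%:E)%E.
Proof.
elim: q => // -[|q] IH _ ar.
  by rewrite !big_ord_recr !big_ord0/= add0e add0r ar.
rewrite big_ord_recr [in ltRHS]big_ord_recr EFinD; apply: lteD; last exact: ar.
by apply: IH => // i iq; apply: ar; rewrite ltnS ltnW.
Qed.

Section UpperBound.
Context {d : measure_display} {X : measurableType d} {R : realType}.
Variables (mu : probability X R) (T : X -> X).

Definition deviation_set (xi : X -> R) (e : R) (n : nat) : set X :=
  [set x | e < `| n%:R^-1 * (\sum_(j < n) xi (iter j T x)) - \int[mu]_y xi y |].

Lemma measurable_deviation_set xi e n : measurable_fun setT T ->
  measurable_fun setT xi -> measurable (deviation_set xi e n).
Proof.
move=> mT mxi; rewrite -[deviation_set _ _ _]setTI.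
rewrite (_ : deviation_set xi e n =
    (fun x => `| n%:R^-1 * (\sum_(j < n) xi (iter j T x)) - \int[mu]_y xi y |)
    @^-1` `]e, +oo[); last first.
  by apply/seteqP; split=> x /=; rewrite in_itv/= andbT.
suff mg : measurable_fun setT (fun x =>
    `| n%:R^-1 * (\sum_(j < n) xi (iter j T x)) - \int[mu]_y xi y |).
  exact: mg.
apply: measurableT_comp => //.
apply: measurable_funB; last exact: measurable_cst.
apply: measurable_funM; first exact: measurable_cst.
apply: measurable_sum => j; apply: measurableT_comp => //.
exact: measurable_iter.
Qed.

(** A level of the logarithm becomes, by exponentiation, a positive level of the norm, so points
    where the product vanishes belong to neither set. Compatibility thus applies to the steps. *)
Lemma norm_algebra_superlevel m (A : X -> 'M[R]_m) p K h i : (0 < p)%N ->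
  norm_algebra T A p (superlevel (log_growth T A p) K h i).
Proof.
move=> p0; apply: sub_gen_smallest; exists p, (expR (p%:R * (- K + h *+ i.+1))).
split; [exact: leqnn|exact: expR_ge0|right].
have p0' : 0 < p%:R :> R by rewrite ltr0n.
apply/seteqP; split=> x; rewrite /superlevel /= /log_growth.
  have [g0|g0] := leP (opnorm (iterate T A p x)) 0.
    by rewrite le0_lneNy ?lee_fin// gt0_muleNy ?lte_fin ?invr_gt0// leeNy_eq.
  rewrite lne_EFin// -EFinM lee_fin [leRHS]mulrC ler_pdivlMr//.
  rewrite [leLHS]mulrC => gb; by rewrite -[leRHS]lnK// ler_expR.
move=> gb; have g0 := lt_le_trans (expR_gt0 _) gb.
rewrite lne_EFin// -EFinM lee_fin [leRHS]mulrC ler_pdivlMr// [leLHS]mulrC.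
by rewrite -ler_expR lnK.
Qed.

Hypothesis hT : ergodic_system mu T.
Let mT : measurable_fun setT T. Proof. exact: ergodic_measurable hT. Qed.

(** The Birkhoff average of each indicator exceeds its mean by at most 1/q for the mean of the
    observable above it plus 1/q for the deviation. Over [q] indicators of weight [h] this costs 2h,
    on top of the [h *+ 2] in [step_fun]. *)
Lemma sum_step_fun_le (f : X -> \bar R) (mf : measurable_fun setT f)
    (K h : R) (q n : nat) (xi : nat -> X -> R) (x : X) :
  0 < h -> (0 < q)%N -> (0 < n)%N ->
  (forall i, mu.-integrable setT (EFin \o xi i)) ->
  (forall i y, \1_(superlevel f K h i) y <= xi i y) ->
  (forall i, (\int[mu]_y (xi i y)%:E <=
     mu (superlevel f K h i) + (q%:R^-1)%:E)%E) ->
  (forall i, (i < q)%N -> ~ deviation_set (xi i) q%:R^-1 n x) ->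
  \sum_(j < n) step_fun f K h q (iter j T x) <=
  n%:R * (- K + h *+ 4 + h * \sum_(i < q) fine (mu (superlevel f K h i))).
Proof.
move=> h0 q0 n0 ixi Fxi xiF dev.
have n0' : 0 < n%:R :> R by rewrite ltr0n.
have q0' : 0 < q%:R :> R by rewrite ltr0n.
rewrite /step_fun big_split/= sumr_const card_ord -[_ *+ n]mulr_natl -mulr_sumr.
rewrite exchange_big/=.
have : \sum_(i < q) \sum_(j < n) \1_(superlevel f K h i) (iter j T x) <=
    \sum_(i < q) n%:R * (fine (mu (superlevel f K h i)) + q%:R^-1 * 2).
  apply: ler_sum => i _.
  apply: (@le_trans _ _ (\sum_(j < n) xi i (iter j T x))); first exact: ler_sum.
  have := dev i (ltn_ord i); rewrite /deviation_set /= => /negP; rewrite -leNgt.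
  move=> /(le_trans (ler_norm _)); rewrite lerBlDr [leLHS]mulrC ler_pdivrMr//.
  move=> /le_trans; apply; rewrite [leLHS]mulrC ler_wpM2l//.
  have : \int[mu]_y xi i y <= fine (mu (superlevel f K h i)) + q%:R^-1.
    have mF := measurable_superlevel mf K h i.
    have := xiF i; have := integrable_fin_num measurableT (ixi i).
    rewrite /Rintegral -{1}[mu (superlevel _ _ _ _)]fineK ?fin_num_measure//.
    by move=> /= fi xiFi; rewrite -lee_fin fineK// EFinD.
  by lra.
rewrite -mulr_sumr big_split/= sumr_const card_ord -[_ *+ q]mulr_natl.
rewrite mulrA mulfV ?gt_eqF// mul1r => le1.
have := ler_wpM2l (ltW h0) le1; lra.
Qed.

(** The margin is used additively: exp (p s) - exp (p (s - h)) = exp (p s) (1 - exp (- p h)), which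
    [- K <= s] bounds below uniformly in [x]. Closeness in norm thus suffices even where the product
    of [A] vanishes. *)
Lemma perturbed_block_le m (A B : X -> 'M[R]_m) (c K h s e : R) p x :
  1 <= c -> 0 <= e -> 0 < h -> (0 < p)%N ->
  (forall j, opnorm (A (iter j T x)) <= c) ->
  (forall j, opnorm (B (iter j T x)) <= c) ->
  (forall j, opnorm (B (iter j T x) - A (iter j T x)) <= e) ->
  p%:R * e * c ^+ p <= expR (p%:R * - K) * (1 - expR (p%:R * - h)) ->
  - K <= s -> opnorm (iterate T A p x) <= expR (p%:R * (s - h)) ->
  opnorm (iterate T B p x) <= expR (p%:R * s).
Proof.
move=> c1 e0 h0 p0 Ac Bc BA small Ks As.
have p0' : 0 < p%:R :> R by rewrite ltr0n.
have := opnorm_iterateB p c1 e0 Ac Bc BA.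
have : opnorm (iterate T B p x) <=
    opnorm (iterate T B p x - iterate T A p x) + opnorm (iterate T A p x).
  by rewrite -{1}(subrK (iterate T A p x) (iterate T B p x)) opnormD.
move: As; rewrite mulrBr expRD -mulrN.
have : expR (p%:R * - K) * (1 - expR (p%:R * - h)) <=
       expR (p%:R * s) * (1 - expR (p%:R * - h)).
  apply: ler_wpM2r; last by rewrite ler_expR ler_pM2l.
  by rewrite subr_ge0 -[leRHS]expR0 ler_expR pmulr_rle0// oppr_le0 ltW.
lra.
Qed.

Variables (C : cocycle_space mu) (Xi : set (X -> R)) (P : LDT_parameters R).
Variables (m : nat) (A : X -> 'M[R]_m).
Hypotheses (hXi : forall xi, Xi xi -> measurable_fun setT xi) (hA : C m A)
  (hcompat : compatible mu T A Xi)
  (hLDT : forall xi, Xi xi -> base_LDT mu T P xi).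

Lemma cocycle_ae_bound : exists c : R, 1 <= c /\
  {ae mu, forall x, opnorm (A x) <= c}.
Proof.
have := cocycle_bounded hA.
have := Lnorm_ge0 mu +oo%E (fun x => (opnorm (A x))%:E).
rewrite -/(norm_Linfty mu A); case E : (norm_Linfty mu A) => [r|//|//] _ _.
exists (Num.max 1 r); rewrite le_max lexx; split=> //.
by apply: norm_Linfty_ae; rewrite E lee_fin le_max lexx orbT.
Qed.

(** It suffices to find the exceptional set common to all [B]: for a given [B], the null set where
    the bound fails is adjoined to it. *)
Lemma upper_bound_near_ae (b delta : R) n0 (iota : R -> R) :
  (forall n, (n0 <= n)%N ->
     exists S, [/\ measurable S, (mu S < (iota n%:R)%:E)%E &
       forall B : X -> 'M[R]_m, C m B -> cdist C B A < delta ->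
         {ae mu, forall x, ~ S x -> (log_growth T B n x <= b%:E)%E}]) ->
  upper_bound_near T C A b%:E delta n0 iota.
Proof.
move=> unif; split=> // B n CB BA /unif[S [mS Si /(_ B CB BA)[N [mN N0 SN]]]].
exists (S `|` N); split; first exact: measurableU.
  apply: le_lt_trans Si; apply: le_trans (measureU2 mu mS mN) _.
  by rewrite [X in (_ + X)%E]N0 adde0.
move=> x /not_orP[Sx Nx]; apply: contrapT => xb.
by apply: Nx; apply: SN => /= /(_ Sx).
Qed.

Lemma upper_bound_near_of_block (b : R) p : (0 < p)%N ->
  (\int[mu]_x log_growth T A p x < b%:E)%E ->
  exists (delta : R) (n0 : nat) (iota : R -> R),
    [/\ 0 < delta, (0 < n0)%N, measures P iota &
        upper_bound_near T C A b%:E delta n0 iota].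
Proof.
move=> p0; have [c [c1 Ac]] := cocycle_ae_bound.
have mA := cocycle_measurable hA.
have mf := measurable_log_growth p mT mA.
have fc := log_growth_ub_ae hT c1 Ac p0.
move=> /(step_integral_lt mf fc)[K [h [q [h0 q0 cq]]]].
set f := log_growth T A p in mf fc cq *.
have mF i := measurable_superlevel mf K h i.
rewrite sum_measure_fine// -EFinM lee_fin => hS.
have q0' : 0 < q%:R^-1 :> R by rewrite invr_gt0 ltr0n.
have p0' : 0 < p%:R :> R by rewrite ltr0n.
(* One observable per level, with tolerance 1/q since [q] of them are summed. *)
have /choice[xi xiP] i := hcompat (norm_algebra_superlevel K h i p0) q0'.
have /choice[w wP] i : exists w : nat * (R -> R) * (R -> R), triplets P w /\
    forall n, (w.1.1 <= n)%N -> w.1.2 n%:R <= q%:R^-1 /\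
      (mu (deviation_set (xi i) (w.1.2 n%:R) n) < (w.2 n%:R)%:E)%E.
  have [Xixi _ _] := xiP i; have [_ /(_ _ q0')] := hLDT Xixi.
  by move=> [n1 [e [iota [Pw wn]]]]; exists (n1, e, iota).
pose iota i := (w i).2; pose e i := (w i).1.2.
(* [c'] bounds almost surely both [A] and every [B] within distance 1 of it. *)
pose c' := c + 1; pose D := ln c' *+ (2 * p) + K *+ p.
pose rho := expR (p%:R * - K) * (1 - expR (p%:R * - h)).
have rho0 : 0 < rho.
  rewrite mulr_gt0 ?expR_gt0// subr_gt0 -[ltRHS]expR0 ltr_expR.
  by rewrite pmulr_rlt0// oppr_lt0.
have c0' : 0 < c' by rewrite /c'; lra.
(* The second entry gives p delta c'^p <= rho, the smallness asked for in [perturbed_block_le]. *)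
pose delta := Num.min 1 (rho / (p%:R * c' ^+ p)).
have delta0 : 0 < delta.
  by rewrite lt_min ltr01 divr_gt0// mulr_gt0// exprn_gt0.
(* The scale passes the thresholds of all [q] deviation estimates, exceeds a block and makes D <= n
   h. The measures add up by the union bound. *)
exists delta, (maxn (\max_(i < q) (w i).1.1) (maxn p.+1 (Num.bound `|D / h|))),
  (fun t => \sum_(i < q) iota i t); split=> //.
- by rewrite !leq_max orbT.
- apply: measures_sum => // i; have [+ _] := wP i.
  by rewrite /iota; case: (w i) => -[? ?] ? /tripletsP[].
apply: upper_bound_near_ae => n; rewrite !geq_max => /and3P[wn pn Dn].
have n0 : (0 < n)%N by rewrite (leq_ltn_trans _ pn).
have n0' : 0 < n%:R :> R by rewrite ltr0n.
have wn' i : (i < q)%N -> ((w i).1.1 <= n)%N.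
  by move=> iq; apply: leq_trans wn; exact: (leq_bigmax (Ordinal iq)).
pose E i := deviation_set (xi i) (e i n%:R) n.
have mE i : measurable (E i).
  apply: measurable_deviation_set => //; apply: hXi.
  by have [] := xiP i.
(* This set is fixed before [B] is introduced. *)
exists (\big[setU/set0]_(i < q) E i); split.
- by apply: bigsetU_measurable => i _; exact: mE.
- apply: le_lt_trans (Boole_inequality mu (fun i _ => mE i)) _.
  apply: (@lte_sum_EFin _ (mu \o E) (fun i => iota i n%:R)) => // i iq.
  by have [_ /(_ n (wn' i iq))[]] := wP i.
move=> B CB BA.
have Bdelta : {ae mu, forall x, opnorm (B x - A x) <= delta}.
  apply: norm_Linfty_ae; apply: le_trans (cdist_Linfty hA CB) _.
  by rewrite lee_fin ltW.
have step := ae_iter hT (le_step_fun fc h0 cq).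
apply: filterS3 (ae_iter hT Ac) (ae_iter hT Bdelta) step => x Acx BAx fx Sx.
have Ac' j : opnorm (A (iter j T x)) <= c'.
  by rewrite (le_trans (Acx j))// /c'; lra.
have delta1 : delta <= 1 by rewrite ge_min lexx.
have Bc' j : opnorm (B (iter j T x)) <= c'.
  rewrite -[B _](subrK (A (iter j T x))) (le_trans (opnormD _ _))//.
  by have := Acx j; have := BAx j; rewrite /c'; lra.
have small : p%:R * delta * c' ^+ p <= rho.
  rewrite mulrAC mulrC -ler_pdivlMr ?mulr_gt0 ?exprn_gt0//.
  by rewrite ge_min lexx orbT.
have c1' : 1 <= c' by rewrite /c'; lra.
apply: log_growth_le => //.
apply: le_trans (opnorm_iterate_sum (s := step_fun f K h q) (K := K)
  p0 c1' Bc' _ _ (ltnW pn)) _.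
- move=> j; apply: (perturbed_block_le c1' (ltW delta0) h0 p0 _ _ _ small)
    => [i|i|i||].
  + by rewrite -iterD.
  + by rewrite -iterD.
  + by rewrite -iterD.
  + exact: step_fun_ge.
  + by apply: log_growth_leP => //; exact: fx.
- by move=> j; exact: step_fun_ge.
rewrite ler_expR -/D.
have Dh : D <= n%:R * h.
  rewrite -ler_pdivrMr// (le_trans (ler_norm _))//.
  by rewrite (le_trans (ltW (archi_boundP _)))// ler_nat.
have dev i : (i < q)%N -> ~ deviation_set (xi i) q%:R^-1 n x.
  move=> iq xE; apply: Sx; rewrite -bigcup_mkord; exists i => //.
  have [_ /(_ n (wn' i iq))[eq _]] := wP i.
  exact: le_lt_trans eq xE.
have := @sum_step_fun_le f mf K h q n xi x h0 q0 n0 _ _ _ dev.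
have ixi i : mu.-integrable setT (EFin \o xi i) by have [/hLDT[]] := xiP i.
move=> /(_ ixi (fun i => let: And3 _ h _ := xiP i in h)).
move=> /(_ (fun i => let: And3 _ _ h := xiP i in h)) le1.
(* With S the sum of the measures of the levels, D + n (- K + 4h + h S) <= n (- K + 5h + h S) <= n
   b. *)
have := ler_wpM2l (ltW n0') hS; lra.
Qed.

End UpperBound.

Theorem proposition2p1 (R : realType) (d : measure_display)
    (X : measurableType d) (mu : probability X R) (T : X -> X)
    (C : cocycle_space mu) (Xi : set (X -> R)) (P : LDT_parameters R)
    (m : nat) (A : X -> 'M[R]_m)
    (hT : ergodic_system mu T)
    (hXi : forall xi, Xi xi -> measurable_fun setT xi)
    (hA : C m A)
    (hcompat : compatible mu T A Xi)
    (hLDT : forall xi, Xi xi -> base_LDT mu T P xi) :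
  ((-oo < lyapunov1 mu T A)%E -> L1_bounded mu T A ->
   forall eps : R, 0 < eps ->
     exists (delta : R) (n0 : nat) (iota : R -> R),
       [/\ 0 < delta, (0 < n0)%N, measures P iota &
         upper_bound_near T C A (lyapunov1 mu T A + eps%:E)%E delta n0 iota])
  /\
  (lyapunov1 mu T A = -oo%E ->
   forall t : R,
     exists (delta : R) (n0 : nat) (iota : R -> R),
       [/\ 0 < delta, (0 < n0)%N, measures P iota &
         upper_bound_near T C A (- t)%:E delta n0 iota]).
Proof.
have [c [c1 Ac]] := cocycle_ae_bound hA.
have mA := cocycle_measurable hA.
(* Both parts are instances of one bound for a real [b] above the exponent: [b] is L_1(A) + eps in
   the first and - t in the second. *)
have main (b : R) : (lyapunov1 mu T A < b%:E)%E ->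
    exists (delta : R) (n0 : nat) (iota : R -> R),
      [/\ 0 < delta, (0 < n0)%N, measures P iota &
          upper_bound_near T C A b%:E delta n0 iota].
  rewrite (lyapunov1E hT mA c1 Ac) => /ereal_inf_lt[_ [p /= p0 <-]].
  exact: (upper_bound_near_of_block hT hXi hA hcompat hLDT p0).
split=> [Ly _ eps eps0|Ly t]; last by apply: main; rewrite Ly ltNyr.
have := lyapunov1_lty hT mA c1 Ac; move: Ly main.
case: (lyapunov1 mu T A) => [l|//|//] _ main _.
by rewrite -EFinD; apply: main; rewrite lte_fin; lra.
Qed.
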